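(* The linear transformation with respect to the triangular array $\left\{\binom{n}{k}^2\right\}_{0\leq k\leq n}$ is log-convexity preserving. That is, for every log-convex sequence $\{x_k\}_{k\ge 0}$ of nonnegative real numbers, the sequence $\{y_n\}_{n\ge 0}$ defined by $y_n=\sum_{k=0}^n\binom{n}{k}^2x_k$ is log-convex.
   Context: A sequence $\{a_k\}_{k\geq 0}$ of nonnegative numbers is log-convex if $a_{k-1}a_{k+1}\geq a_{k}^2$ for all $k\geq 1$. The linear transformation on a sequence $\{x_k\}_{k\geq 0}$ with respect to a triangular array $\{a(n,k)\}_{0\leq k\leq n}$ of numbers is $y_n=\sum_{k=0}^n a(n,k)x_k$; it is called log-convexity preserving if $\{y_n\}_{n\geq 0}$ is log-convex whenever $\{x_k\}_{k\geq 0}$ is log-convex. *)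

(* Defs.v *)
From mathcomp Require Import all_boot all_order all_algebra.
From mathcomp Require Import reals.

Set Implicit Arguments.
Unset Strict Implicit.
Unset Printing Implicit Defensive.

Import Order.TTheory GRing.Theory Num.Theory.
Local Open Scope ring_scope.

Definition log_convex (R : realType) (a : nat -> R) : Prop :=
  (forall k : nat, 0 <= a k) /\
  (forall k : nat, (1 <= k)%N -> a k.-1 * a k.+1 >= a k ^+ 2).

(* A triangular array {a(n,k)}, 0 <= k <= n, is a total function of n and k;
   its values at k > n are never used. *)
Definition linear_transform (R : realType) (a : nat -> nat -> R)
    (x : nat -> R) (n : nat) : R :=
  \sum_(0 <= k < n.+1) a n k * x k.

Definition log_convexity_preserving (R : realType) (a : nat -> nat -> R) : Prop :=
  forall x : nat -> R, log_convex x -> log_convex (linear_transform a x).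

(* Main.v *)
Require Import Defs.
From mathcomp Require Import all_boot all_order all_algebra.
From mathcomp Require Import reals.
From mathcomp Require Import ring zify.

Set Implicit Arguments.
Unset Strict Implicit.
Unset Printing Implicit Defensive.

Import Order.TTheory GRing.Theory Num.Theory.
Local Open Scope ring_scope.

(** Let y be the transform of a log-convex sequence x. The number
    y_n * y_(n+2) - y_(n+1)^2 is a quadratic form in x, the sum over all i and j
    of minor_coef n i j * x_i * x_j. In general its coefficients have both signs,
    even after symmetrization in i and j. What is known about x is that it is
    nonnegative and that x_i * x_(j+1) >= x_(i+1) * x_j for i <= j
    ([log_convex_exchange]); so a multiple of the form has to be written as

      sum of beta(i,j) * x_i * x_j
        + sum of W(i,j) * (x_i * x_(j+1) - x_(i+1) * x_j),

    with a symmetric beta >= 0 and with W(i,j) >= 0 for i <= j. The second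
    factor of the second sum is antisymmetric in i and j, hence W may be taken
    antisymmetric too; then it has the right sign everywhere once it does for
    i <= j.

    Such a W exists in closed form. With N = n + 1 it is

      W(i,j) = C(N,i)^2 * C(N,j)^2 * (j - i) * slope N i j,

    where slope is an explicit nonnegative rational function ([weight],
    [weight_ge0]). Dividing beta by the squares of C(N+1,i) and C(N+1,j) leaves,
    up to a positive constant, a rational function of N, i and j, called
    [defect] below, and the whole proof comes down to [defect_ge0]. In the variables i, d = j - i and b = N + 1 - j
    the defect is d^2 times a polynomial over a positive denominator
    ([defectE]). That polynomial is quadratic in i, and its three coefficients
    are nonnegative for integers b >= 0 and d >= 1 ([defect_coef_ge0]). *)

(** * Log-convex sequences and symmetric double sums *)

(** Where x is positive, this says that the ratios x_(k+1) / x_k increase. The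
    induction on j avoids the ratios: if x_(j+1) = 0 the right-hand side is
    merely nonnegative, and otherwise x_j > 0 can be cancelled. *)
Lemma log_convex_exchange (R : realType) (x : nat -> R) (i j : nat) :
  log_convex x -> (i <= j)%N -> x i.+1 * x j <= x i * x j.+1.
Proof.
move=> [x_ge0 x_lc]; elim: j => [|j IHj].
  by rewrite leqn0 => /eqP ->; rewrite mulrC.
rewrite leq_eqVlt => /orP[/eqP ->|/IHj {}IHj]; first by rewrite mulrC.
have lc_j : x j.+1 ^+ 2 <= x j * x j.+2 by exact: (x_lc j.+1).
have [xj1_eq0|xj1_gt0] : x j.+1 = 0 \/ 0 < x j.+1.
  by have := x_ge0 j.+1; rewrite le_eqVlt => /orP[/eqP <-|]; [left|right].
  by rewrite xj1_eq0 mulr0 mulr_ge0.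
have xj_gt0 : 0 < x j.
  rewrite lt_neqAle x_ge0 andbT; apply/eqP => xj_eq0.
  by move: lc_j; rewrite -xj_eq0 mul0r leNgt exprn_gt0.
rewrite -(ler_pM2r xj_gt0).
apply: (@le_trans _ _ (x i * x j.+1 * x j.+1)).
  by rewrite mulrAC ler_wpM2r.
by rewrite -!mulrA ler_wpM2l // -expr2 [x j.+2 * _]mulrC.
Qed.

(** Exchanging the two summations and averaging replaces f by its symmetric
    part. *)
Lemma sumr_sym_ge0 (R : realFieldType) (n : nat) (f : 'I_n -> 'I_n -> R) :
  (forall i j, 0 <= f i j + f j i) -> 0 <= \sum_i \sum_j f i j.
Proof.
move=> f_ge0; rewrite -(pmulrn_lge0 _ (ltn0Sn 1)) mulr2n.
rewrite [X in _ + X]exchange_big -big_split; apply: sumr_ge0 => i _.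
rewrite -big_split; apply: sumr_ge0 => j _; exact: f_ge0.
Qed.

(** * The rational certificate *)

Section RationalCertificate.

Variable R : realFieldType.
Implicit Types n x y i j b d : R.

(** Put k = (x + y) * (2 * n - x - y). The last factor is k + 1 - (y - x)^2, so
    that it equals k when |y - x| = 1; the fraction is scaled so that k times it
    is the least value for which the defect below is nonnegative at i = j, where
    only |y - x| = 1 occurs. The decrease with (y - x)^2 is what keeps the defect
    nonnegative away from the diagonal. Where k = 0 the quotient is 0 by convention, which is harmless: for
    0 <= x, y <= n this means x = y, and the slope is always multiplied by
    y - x. *)
Definition slope n x y : R :=
  ((2 * n + 1) * (2 * n - x - y) - 1)
    / ((x + y + 1) * ((x + y) * (2 * n - x - y)))
  * (2 * x * (n - x) + 2 * y * (n - y) + 1).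

(** Up to the square of C(n+1,i) * C(n+1,j) / (n+1)^2, this is the coefficient
    of x_i * x_j in n^2 * (y_(n-1) * y_(n+1) - y_n^2), symmetrized in i and j, minus
    what the weights W(i,j-1) and W(j,i-1) contribute to it
    ([minor_coef_sym]). *)
Definition defect n i j : R :=
  (n + 1) ^+ 2 * ((n + 1 - i) ^+ 2 * (n - i) ^+ 2
                  + (n + 1 - j) ^+ 2 * (n - j) ^+ 2)
  - 2 * n ^+ 2 * (n + 1 - i) ^+ 2 * (n + 1 - j) ^+ 2
  - (n + 1 - i) ^+ 2 * j ^+ 2 * (j - 1 - i) * slope n i (j - 1)
  - (n + 1 - j) ^+ 2 * i ^+ 2 * (i - 1 - j) * slope n j (i - 1).

Lemma slopeC n x y : slope n x y = slope n y x.
Proof.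
rewrite /slope (addrC x y) -!(addrA (2 * n)) (addrC (- x) (- y)).
by congr (_ * _); ring.
Qed.

Lemma slope_ge0 (n i j : nat) :
  (i <= n)%N -> (j <= n)%N -> 0 <= slope n%:R i%:R j%:R.
Proof.
move=> le_in le_jn.
have n_i : 0 <= n%:R - i%:R :> R by rewrite subr_ge0 ler_nat.
have n_j : 0 <= n%:R - j%:R :> R by rewrite subr_ge0 ler_nat.
rewrite /slope; apply: mulr_ge0; last first.
  by rewrite !addr_ge0 // !mulr_ge0.
have -> : 2 * n%:R - i%:R - j%:R = (n - i + (n - j))%:R :> R.
  by rewrite natrD !natrB //; ring.
case: (n - i + (n - j))%N => [|k]; first by rewrite !(mulr0, invr0).
apply: divr_ge0; last by rewrite !mulr_ge0 ?addr_ge0.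
rewrite subr_ge0 mulrDl mul1r -[leLHS]add0r lerD ?mulr_ge0 //.
by rewrite ler1n.
Qed.

(** For b = 0 the numerator of the defect in [defectE] reduces to
   d^2 * boundary d * (i + d)^2. *)
Let boundary d := d * (d - 1) * (d - 2) * (d ^+ 2 - d - 1).

Definition defect_coef0 b d :=
  (d - 1) * (4 * b ^+ 5 + 2 * (5 * d - 3) * b ^+ 4
     + 2 * (d ^+ 3 + 2 * d ^+ 2 - 7 * d + 1) * b ^+ 3
     + d * (5 * d ^+ 3 - 9 * d ^+ 2 - 9 * d + 6) * b ^+ 2
     + 2 * d ^+ 2 * (d - 1) * (2 * d ^+ 2 - 3 * d - 3) * b) + d ^+ 2 * boundary d.

Definition defect_coef1 b d :=
  8 * b ^+ 5 + 4 * (7 * d - 3) * b ^+ 4 + 4 * (5 * d ^+ 2 - 5 * d + 2) * b ^+ 3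
  + 2 * (d - 1) * (2 * d ^+ 3 - 6 * d ^+ 2 - 4 * d + 3) * b ^+ 2
  + 2 * d * (d - 1) ^+ 2 * (3 * d ^+ 2 - 6 * d - 5) * b + 2 * d * boundary d.

Definition defect_coef2 b d :=
  8 * b ^+ 4 + 4 * (4 * d + 1) * b ^+ 3 + 2 * (1 + 3 * d - d ^+ 2) * b ^+ 2
  + 2 * (d - 1) ^+ 2 * (d ^+ 2 - 3 * d - 2) * b + boundary d.

(** The three arguments of the defect satisfy i + d + b = n + 1, the change of
    variables that turns the constraints 0 <= i <= j <= n + 1 into
    i, d, b >= 0. *)
Lemma defectE i b d (r := 2 * i + d) (m := 2 * b + d) :
  r != 0 -> r - 1 != 0 -> m - 1 != 0 ->
  defect (i + d + b - 1) i (i + d)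
  = d ^+ 2 * (defect_coef0 b d + defect_coef1 b d * i + defect_coef2 b d * i ^+ 2)
    / (r * (r - 1) * (m - 1)).
Proof.
rewrite /r /m => r0 r1 m1; rewrite /defect /slope.
have -> : 2 * (i + d + b - 1) - i - (i + d - 1) = 2 * b + d - 1 by ring.
have -> : 2 * (i + d + b - 1) - (i + d) - (i - 1) = 2 * b + d - 1 by ring.
have -> : i + (i + d - 1) + 1 = 2 * i + d by ring.
have -> : i + d + (i - 1) + 1 = 2 * i + d by ring.
have -> : i + (i + d - 1) = 2 * i + d - 1 by ring.
have -> : i + d + (i - 1) = 2 * i + d - 1 by ring.
rewrite /defect_coef0 /defect_coef1 /defect_coef2 /boundary; field.
by rewrite m1 r1.
Qed.

Ltac nonneg := repeat first
  [ exact: ler0n | exact: ler01 | assumption | exact: sqr_ge0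
  | apply: addr_ge0 | apply: mulr_ge0 | apply: exprn_ge0 ].

(** Integrality matters: for d = 2 the first coefficient vanishes at b = 0 and at
    b = 1 and is negative in between. From d = 3 on, in powers of d - 3 and b,
    only four monomials have a negative sign. *)
Lemma defect_coef_ge0 (b d : nat) : (0 < d)%N ->
  [/\ 0 <= defect_coef0 b%:R d%:R, 0 <= defect_coef1 b%:R d%:R
    & 0 <= defect_coef2 b%:R d%:R].
Proof.
rewrite /defect_coef0 /defect_coef1 /defect_coef2 /boundary.
case: d => [//|[|[|e]]] _.
- set B := b%:R; have B_ge0 : 0 <= B by exact: ler0n.
  split.
  + by rewrite (_ : _ + _ = 0) //; ring.
  + by rewrite (_ : _ + _ = 8 * B ^+ 5 + 16 * B ^+ 4 + 8 * B ^+ 3); [nonneg | ring].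
  + by rewrite (_ : _ + _ = 8 * B ^+ 4 + 20 * B ^+ 3 + 6 * B ^+ 2); [nonneg | ring].
- case: b => [|c].
    by split; rewrite le_eqVlt; apply/orP; left; apply/eqP; ring.
  (* In powers of b - 1 all signs are positive. *)
  rewrite -[c.+1]addn1 natrD; set C := c%:R; have C_ge0 : 0 <= C by exact: ler0n.
  split.
  + rewrite (_ : _ + _ = 4 * C ^+ 5 + 34 * C ^+ 4 + 102 * C ^+ 3 + 126 * C ^+ 2 + 54 * C).
      by nonneg.
    ring.
  + rewrite (_ : _ + _ = 8 * C ^+ 5 + 84 * C ^+ 4 + 304 * C ^+ 3 + 462 * C ^+ 2
                         + 288 * C + 54); first by nonneg.
    ring.
  + rewrite (_ : _ + _ = 8 * C ^+ 4 + 68 * C ^+ 3 + 162 * C ^+ 2 + 144 * C + 42).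
      by nonneg.
    ring.
- rewrite -[e.+3]addn3 natrD; set B := b%:R; set E := e%:R.
  have B_ge0 : 0 <= B by exact: ler0n.
  have E_ge0 : 0 <= E by exact: ler0n.
  have B31 : 0 <= B ^+ 3 - B.
    by rewrite subr_ge0 -natrX ler_nat; case: (b) => // k; rewrite -{1}(expn1 k.+1) leq_pexp2l.
  have B32 : 0 <= B ^+ 3 - B ^+ 2.
    by rewrite subr_ge0 -!natrX ler_nat; case: (b) => // k; rewrite leq_pexp2l.
  split.
  + rewrite (_ : _ + _ =
      (4 * E + 8) * B ^+ 5 + (10 * E ^+ 2 + 44 * E + 48) * B ^+ 4
      + (2 * E ^+ 4 + 26 * E ^+ 3 + 108 * E ^+ 2 + 178 * E + 100) * B ^+ 3
      + (5 * E ^+ 5 + 61 * E ^+ 4 + 282 * E ^+ 3 + 609 * E ^+ 2 + 597 * E + 198) * B ^+ 2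
      + (4 * E ^+ 6 + 58 * E ^+ 5 + 340 * E ^+ 4 + 1026 * E ^+ 3 + 1668 * E ^+ 2
         + 1368 * E + 432) * B
      + (E ^+ 7 + 17 * E ^+ 6 + 121 * E ^+ 5 + 466 * E ^+ 4 + 1045 * E ^+ 3
         + 1359 * E ^+ 2 + 945 * E + 270)); first by nonneg.
    ring.
  + rewrite (_ : _ + _ =
      36 * (B ^+ 3 - B ^+ 2) + 8 * B ^+ 5 + (28 * E + 72) * B ^+ 4
      + (20 * E ^+ 2 + 100 * E + 92) * B ^+ 3
      + (4 * E ^+ 4 + 32 * E ^+ 3 + 76 * E ^+ 2 + 38 * E) * B ^+ 2
      + (6 * E ^+ 5 + 66 * E ^+ 4 + 272 * E ^+ 3 + 512 * E ^+ 2 + 416 * E + 96) * B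
      + (2 * E ^+ 6 + 28 * E ^+ 5 + 158 * E ^+ 4 + 458 * E ^+ 3 + 716 * E ^+ 2
         + 570 * E + 180)); first by nonneg.
    ring.
  (* The square absorbs the monomial - 2 * B^2 * E^2; the other three negative
     ones are absorbed by multiples of B^3. *)
  + rewrite (_ : _ + _ =
      16 * (B ^+ 3 - B) + 6 * E * (B ^+ 3 - B ^+ 2) + (B ^+ 2 - E ^+ 2) ^+ 2
      + 7 * B ^+ 4 + (10 * E + 36) * B ^+ 3 + 2 * B ^+ 2
      + (2 * E ^+ 4 + 14 * E ^+ 3 + 28 * E ^+ 2 + 8 * E) * B
      + (E ^+ 5 + 10 * E ^+ 4 + 46 * E ^+ 3 + 91 * E ^+ 2 + 85 * E + 30)).
      by nonneg.
    ring.
Qed.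

Lemma defect_ge0_ordered (i b d n : nat) :
  (i + d + b = n.+1)%N -> 0 <= defect n%:R i%:R (i + d)%:R.
Proof.
move=> def_n.
have -> : n%:R = i%:R + d%:R + b%:R - 1 :> R.
  by rewrite -!natrD def_n -addn1 natrD addrK.
rewrite natrD.
(* The two degenerate ranges are those where the denominator may vanish. *)
have [r_small|r_big] := leqP (2 * i + d) 1.
  have -> : i = 0%N by lia.
  have /orP[/eqP ->|/eqP ->] : (d == 0)%N || (d == 1)%N by lia.
    by rewrite /defect le_eqVlt; apply/orP; left; apply/eqP; ring.
  rewrite (_ : defect _ _ _ = 2 * b%:R ^+ 2 * (b%:R + 1) ^+ 2); first by nonneg.
  by rewrite /defect; ring.
have [m_small|m_big] := leqP (2 * b + d) 1.
  have -> : b = 0%N by lia.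
  have /orP[/eqP ->|/eqP ->] : (d == 0)%N || (d == 1)%N by lia.
    by rewrite /defect le_eqVlt; apply/orP; left; apply/eqP; ring.
  by rewrite /defect le_eqVlt; apply/orP; left; apply/eqP; ring.
have r1 : 0 < 2 * i%:R + d%:R - 1 :> R by rewrite subr_gt0 -natrM -natrD ltr1n.
have m1 : 0 < 2 * b%:R + d%:R - 1 :> R by rewrite subr_gt0 -natrM -natrD ltr1n.
have r0 : 0 < 2 * i%:R + d%:R :> R by rewrite (lt_trans ltr01) // -subr_gt0.
rewrite defectE ?lt0r_neq0 //; apply: divr_ge0; last by rewrite !mulr_ge0 ?ltW.
have [->|d_gt0] := posnP d; first by rewrite expr0n mul0r.
have [c0 c1 c2] := defect_coef_ge0 b d_gt0.
by nonneg.
Qed.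

Lemma defect_ge0 (n i j : nat) :
  (i <= n.+1)%N -> (j <= n.+1)%N -> 0 <= defect n%:R i%:R j%:R.
Proof.
have main (k l : nat) : (k <= l)%N -> (l <= n.+1)%N -> 0 <= defect n%:R k%:R l%:R.
  move=> le_kl le_ln; rewrite -(subnKC le_kl).
  by apply: (@defect_ge0_ordered _ (n.+1 - l)); rewrite !subnKC.
move=> le_in le_jn; have [le_ij|/ltnW le_ji] := leqP i j; first exact: main.
suff -> : defect n%:R i%:R j%:R = defect n%:R j%:R i%:R by exact: main.
by rewrite /defect; ring.
Qed.

End RationalCertificate.

(** * Weights and binomial coefficients *)

Section Weights.

Variable R : realFieldType.

Definition weight (n i j : nat) : R :=
  'C(n, i)%:R ^+ 2 * 'C(n, j)%:R ^+ 2 * (j%:R - i%:R) * slope n%:R i%:R j%:R.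

(** The coefficient of x_i * x_j in the sum of weight n i k * x_i * x_(k+1)
    over i and k. *)
Definition shifted_weight (n i j : nat) : R :=
  if j is j'.+1 then weight n i j' else 0.

Lemma weightC n i j : weight n j i = - weight n i j.
Proof. by rewrite /weight slopeC; ring. Qed.

Lemma weight_ge0 n i j : (i <= j)%N -> (j <= n)%N -> 0 <= weight n i j.
Proof.
move=> le_ij le_jn; apply: mulr_ge0; last exact: slope_ge0 (leq_trans le_ij _) _.
by rewrite !mulr_ge0 ?sqr_ge0 // subr_ge0 ler_nat.
Qed.

Lemma bin_downr (n k : nat) :
  (n.+1)%:R * 'C(n, k)%:R = (n%:R + 1 - k%:R) * 'C(n.+1, k)%:R :> R.
Proof.
have [le_kn|lt_nk] := leqP k n.+1.
  by rewrite natr1 -natrB // -!natrM -mul_bin_down.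
by rewrite !bin_small ?mulr0 // ltnW.
Qed.

Lemma bin_diagr (n k : nat) :
  (n.+1)%:R * 'C(n, k)%:R = k.+1%:R * 'C(n.+1, k.+1)%:R :> R.
Proof. by rewrite -!natrM -mul_bin_diag. Qed.

(** The identity covers j = 0 as well, because of the factor j^2; this is what
    frees the defect from case distinctions at the boundary. *)
Lemma shifted_weightE n i j :
  n.+1%:R ^+ 4 * shifted_weight n i j
  = ('C(n.+1, i)%:R * 'C(n.+1, j)%:R) ^+ 2 * (n%:R + 1 - i%:R) ^+ 2 * j%:R ^+ 2
    * (j%:R - 1 - i%:R) * slope n%:R i%:R (j%:R - 1).
Proof.
case: j => [|j]; first by rewrite /= expr0n !(mulr0, mul0r).
rewrite /= /weight (_ : j.+1%:R - 1 = j%:R); last by rewrite -natr1 addrK.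
transitivity ((n.+1%:R * 'C(n, i)%:R) ^+ 2 * (n.+1%:R * 'C(n, j)%:R) ^+ 2
              * (j%:R - i%:R) * slope (n%:R : R) i%:R j%:R); first by ring.
by rewrite bin_downr bin_diagr; ring.
Qed.

(** The coefficient of x_i * x_j in y_n * y_(n+2) - y_(n+1)^2, for y the
    transform of x. *)
Definition minor_coef (n i j : nat) : R :=
  'C(n, i)%:R ^+ 2 * 'C(n.+2, j)%:R ^+ 2 - 'C(n.+1, i)%:R ^+ 2 * 'C(n.+1, j)%:R ^+ 2.

(** All six binomial coefficients are rational multiples of C(n+2,i) or
    C(n+2,j), so that a single rational function remains. *)
Lemma minor_coef_sym n i j :
  n.+2%:R ^+ 4 * (n.+1%:R ^+ 2 * (minor_coef n i j + minor_coef n j i)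
                  - shifted_weight n.+1 i j - shifted_weight n.+1 j i)
  = ('C(n.+2, i)%:R * 'C(n.+2, j)%:R) ^+ 2 * defect n.+1%:R i%:R j%:R.
Proof.
rewrite !mulrBr !shifted_weightE.
have down2 k : n.+2%:R * n.+1%:R * 'C(n, k)%:R
    = (n.+1%:R + 1 - k%:R) * (n.+1%:R - k%:R) * 'C(n.+2, k)%:R :> R.
  by rewrite -mulrA bin_downr mulrCA bin_downr natr1; ring.
transitivity (n.+2%:R ^+ 2 * ((n.+2%:R * n.+1%:R * 'C(n, i)%:R) ^+ 2 * 'C(n.+2, j)%:R ^+ 2
                + (n.+2%:R * n.+1%:R * 'C(n, j)%:R) ^+ 2 * 'C(n.+2, i)%:R ^+ 2)
    - 2 * n.+1%:R ^+ 2 * (n.+2%:R * 'C(n.+1, i)%:R) ^+ 2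
        * (n.+2%:R * 'C(n.+1, j)%:R) ^+ 2
    - (('C(n.+2, i)%:R * 'C(n.+2, j)%:R) ^+ 2 * (n.+1%:R + 1 - i%:R) ^+ 2 * j%:R ^+ 2
    * (j%:R - 1 - i%:R) * slope (n.+1%:R : R) i%:R (j%:R - 1))
    - (('C(n.+2, j)%:R * 'C(n.+2, i)%:R) ^+ 2 * (n.+1%:R + 1 - j%:R) ^+ 2 * i%:R ^+ 2
    * (i%:R - 1 - j%:R) * slope (n.+1%:R : R) j%:R (i%:R - 1))).
  by rewrite /minor_coef; ring.
rewrite !down2 !bin_downr /defect natr1; ring.
Qed.

End Weights.

(** * The quadratic form *)

(** Provides a common range of summation for y_n, y_(n+1) and y_(n+2). *)
Lemma linear_transform_widen (R : realType) (x : nat -> R) (m n : nat) :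
  (m <= n)%N ->
  linear_transform (fun n k => ('C(n, k)%:R : R) ^+ 2) x m
  = \sum_(k < n.+1) 'C(m, k)%:R ^+ 2 * x k.
Proof.
move=> le_mn; rewrite /linear_transform.
rewrite -(big_mkord xpredT (fun k => 'C(m, k)%:R ^+ 2 * x k)).
rewrite [RHS](big_cat_nat (n := m.+1)) //= [X in _ + X]big_nat_cond.
rewrite [X in _ + X]big1 ?addr0 // => k /andP[/andP[lt_mk _] _].
by rewrite bin_small // expr0n mul0r.
Qed.

(** After the shift of j, antisymmetry of the weights pairs the terms (i,j) and
    (j,i) into weight n i j * (x_i * x_(j+1) - x_(i+1) * x_j), where both factors
    change sign when i and j are exchanged. *)
Lemma shifted_weight_sum_ge0 (R : realType) (x : nat -> R) (n : nat) :
  log_convex x ->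
  0 <= \sum_(i < n.+2) \sum_(j < n.+2) shifted_weight R n i j * (x i * x j).
Proof.
move=> lc_x.
have shiftE (i : nat) : \sum_(j < n.+2) shifted_weight R n i j * (x i * x j)
    = \sum_(j < n.+1) weight R n i j * (x i * x j.+1).
  by rewrite big_ord_recl /= mul0r add0r.
under eq_bigr => i _ do rewrite shiftE.
rewrite big_ord_recr /= [X in _ + X]big1 ?addr0; last first.
  by move=> j _; rewrite /weight bin_small // expr0n !mul0r.
have pair_ge0 (i j : nat) : (i <= j)%N -> (j <= n)%N ->
    0 <= weight R n i j * (x i * x j.+1) + weight R n j i * (x j * x i.+1).
  move=> le_ij le_jn; rewrite (weightC R n i j) mulNr -mulrBr mulr_ge0 ?weight_ge0 //.
  by rewrite subr_ge0 mulrC log_convex_exchange.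
apply: (@sumr_sym_ge0 _ _ (fun i j => weight R n i j * (x i * x j.+1))) => i j.
have [le_ij|/ltnW le_ji] := leqP i j; first exact: pair_ge0 le_ij (ltn_ord j).
by rewrite addrC; exact: pair_ge0 le_ji (ltn_ord i).
Qed.

Theorem theorem1p3 (R : realType) :
  log_convexity_preserving (fun n k : nat => ('C(n, k)%:R : R) ^+ 2).
Proof.
move=> x lc_x; have [x_ge0 _] := lc_x; split=> [k|[//|n] _ /=].
  by apply: sumr_ge0 => i _; rewrite mulr_ge0 ?sqr_ge0.
rewrite !(linear_transform_widen x (n := n.+2)) ?(leqW (leqnSn n)) //.
rewrite -subr_ge0 -(pmulr_rge0 _ (exprn_gt0 2 (ltr0Sn R n))).
have -> : (\sum_(k < n.+3) 'C(n, k)%:R ^+ 2 * x k)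
      * (\sum_(k < n.+3) 'C(n.+2, k)%:R ^+ 2 * x k)
      - (\sum_(k < n.+3) 'C(n.+1, k)%:R ^+ 2 * x k) ^+ 2
    = \sum_(i < n.+3) \sum_(j < n.+3) minor_coef R n i j * (x i * x j).
  rewrite expr2 !big_distrlr -sumrB; apply: eq_bigr => i _.
  by rewrite -sumrB; apply: eq_bigr => j _; rewrite /minor_coef /=; ring.
(* Only the symmetric part of this form has nonnegative coefficients. *)
have defect_sum_ge0 : 0 <= \sum_(i < n.+3) \sum_(j < n.+3)
    (n.+1%:R ^+ 2 * minor_coef R n i j - shifted_weight R n.+1 i j) * (x i * x j).
  apply: (@sumr_sym_ge0 _ _ (fun i j => (n.+1%:R ^+ 2 * minor_coef R n i j
            - shifted_weight R n.+1 i j) * (x i * x j))) => i j.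
  rewrite [x j * x i]mulrC -mulrDl mulr_ge0 ?mulr_ge0 //.
  rewrite -(pmulr_rge0 _ (exprn_gt0 4 (ltr0Sn R n.+1))).
  rewrite (_ : n.+2%:R ^+ 4 * _ =
    ('C(n.+2, i)%:R * 'C(n.+2, j)%:R) ^+ 2 * defect n.+1%:R i%:R j%:R); last first.
    by rewrite -minor_coef_sym; ring.
  by rewrite mulr_ge0 ?sqr_ge0 // defect_ge0 // -ltnS.
apply: le_trans (addr_ge0 defect_sum_ge0 (shifted_weight_sum_ge0 n.+1 lc_x)) _.
rewrite -big_split mulr_sumr le_eqVlt; apply/orP; left; apply/eqP.
apply: eq_bigr => i _; rewrite -big_split mulr_sumr; apply: eq_bigr => j _ /=.
ring.
Qed.
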